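(* Let $(\Sigma,\Lambda,\rho,\tau)$ be a discrete real Riemann surface of genus $g$, and let $(a_1,\dots,a_g,b_1,\dots,b_g)$ be a symplectic basis of $H_1(\Sigma,\mathbb Z)$, represented by closed paths $\alpha_i,\beta_i$ on the medial graph $X$, such that $\tau(a_i)=a_i$ and $\tau(b_i)=\sum_{j}h_{ji}a_j-b_i$ for a symmetric matrix $H=(h_{ij})$ with entries in $\{0,1\}$. Let $\Pi^{B,B},\Pi^{W,B},\Pi^{B,W},\Pi^{W,W}$ be the blocks of the complete discrete period matrix with respect to this basis. (i) If $\tau$ is of Type 1 (color-preserving), then $2\Re(\Pi^{B,B})=H=2\Re(\Pi^{W,W})$ and $\Re(\Pi^{W,B})=0=\Re(\Pi^{B,W})$. (ii) If $\tau$ is of Type 2 (color-reversing), then $\Pi^{B,B}+\overline{\Pi^{W,W}}=H$ and $\Pi^{W,B}+\overline{\Pi^{B,W}}=0$.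
   Context: A discrete Riemann surface $(\Sigma,\Lambda,\rho)$ consists of a compact connected oriented surface $\Sigma$ of genus $g$, a finite strongly regular cellular decomposition $\Lambda$ of $\Sigma$ into quadrilaterals (two distinct faces are disjoint, share exactly one vertex, or share exactly one edge) whose 1-skeleton is bipartite with a fixed black/white vertex coloring, and $\rho:F(\Lambda)\to\{z\in\mathbb C:\Re z>0\}$. For a face $Q$ its vertices in counterclockwise order are $b_-,w_-,b_+,w_+$ ($b_\pm$ black, $w_\pm$ white). A discrete antiholomorphic involution is a bijection $\tau:V(\Lambda)\to V(\Lambda)$ with $\tau\circ\tau=\mathrm{id}$, a graph automorphism mapping faces to faces and reversing orientation (counterclockwise boundary order of $Q$ maps to clockwise boundary order of $\tau(Q)$), and either Type 1: $\tau$ preserves colors and $\rho_{\tau(Q)}=\overline{\rho_Q}$ for all $Q$, or Type 2: $\tau$ swaps colors and $\rho_{\tau(Q)}=1/\overline{\rho_Q}$ for all $Q$. Then $(\Sigma,\Lambda,\rho,\tau)$ is a discrete real Riemann surface. $\tau$ acts on $H_1(\Sigma,\mathbb Z)$; a symplectic basis satisfies $\mathrm{int}(a_i,a_j)=0=\mathrm{int}(b_i,b_j)$, $\mathrm{int}(a_i,b_j)=\delta_{ij}$. Medial graph $X$: vertices are midpoints of edges of $\Lambda$; two are adjacent iff the corresponding edges share a vertex and lie in a common face. Each face $Q$ contains four edges of $X$ forming a 4-cycle $F_Q$. The edge of $X$ joining the midpoints of edges $uv$ and $vw$ of $Q$ is black if $u,w$ are black and white if $u,w$ are white. $X$ is the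 1-skeleton of a cell decomposition of $\Sigma$ with faces $F_Q$ ($Q\in F(\Lambda)$) and $F_v$ ($v\in V(\Lambda)$, the cycle of $X$ around $v$). $\tau$ induces an automorphism of $X$. A discrete one-form is a function $\omega$ on oriented edges of $X$ with $\omega(-e)=-\omega(e)$; $\int_P\omega=\sum_{e\in P}\omega(e)$. It is of type $\Diamond$ if for every $Q$ it takes equal values on the two black edges of $F_Q$ both oriented from the $b_-$ side toward the $b_+$ side (midpoint of $b_-w_-$ to midpoint of $w_-b_+$, and midpoint of $b_-w_+$ to midpoint of $w_+b_+$), and equal values on the two white edges similarly oriented from $w_-$ toward $w_+$. It is closed if its sum around the boundary of every face $F_Q$, $F_v$ vanishes. For $f$ on the vertices of $Q$, $df(e)=(f(w)-f(u))/2$ for the edge $e$ from the midpoint of $uv$ to the midpoint of $vw$. $f$ is discrete holomorphic on $Q$ if $f(w_+)-f(w_-)=i\rho_Q(f(b_+)-f(b_-))$. A discrete holomorphic differential is a closed one-form of type $\Diamond$ such that for every $Q$ there is $f$ discrete holomorphic on $Q$ with $\omega=df$ on the edges of $F_Q$. For a closed path $P$ on $X$ let $BP$ (resp. $WP$) be its set of oriented black (resp. white) edges; for closed $\omega$ of type $\Diamond$, $2\int_{BP}\omega$ (black period) and $2\int_{WP}\omega$ (white period) depend only on the homology class of $P$. Known fact: for any $2g$ complex numbers there is a unique discrete holomorphic differential with these prescribed black and white $a$-periods $2\int_{B\alpha_k}\omega$, $2\int_{W\alpha_k}\omega$. Let $\omega^B_k$ be the one with black $a_j$-periods $\delta_{jk}$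 and zero white $a$-periods, and $\omega^W_k$ the one with white $a_j$-periods $\delta_{jk}$ and zero black $a$-periods. Then $\Pi^{B,B}_{jk}=2\int_{B\beta_j}\omega^B_k$, $\Pi^{W,B}_{jk}=2\int_{W\beta_j}\omega^B_k$, $\Pi^{B,W}_{jk}=2\int_{B\beta_j}\omega^W_k$, $\Pi^{W,W}_{jk}=2\int_{W\beta_j}\omega^W_k$; the complete discrete period matrix is $\tilde\Pi=\begin{pmatrix}\Pi^{B,W}&\Pi^{B,B}\\ \Pi^{W,W}&\Pi^{W,B}\end{pmatrix}$. *)

(* Defs.v *)
(* (+ mathcomp-real-closed complex numbers R[i], R : realType). *)
From HB Require Import structures.
From mathcomp Require Import all_boot all_order all_algebra complex.
From mathcomp Require Import reals.
Set Implicit Arguments.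
Unset Strict Implicit.
Unset Printing Implicit Defensive.
Import Order.TTheory GRing.Theory Num.Theory.
Local Open Scope ring_scope.

(* Combinatorial model of a discrete (real) Riemann surface.                  *)
(*   V : vertices of Lambda, F : faces (quadrilaterals) of Lambda.             *)
(*   corner Q : 'I_4 -> V lists the vertices of Q in counterclockwise order    *)
(*   b_-, w_-, b_+, w_+  (corner Q 0 = b_-, 1 = w_-, 2 = b_+, 3 = w_+).        *)
(*   black v : v is a black vertex.                                           *)
(* Indices of corners are taken mod 4.                                        *)

Definition nxt (i : 'I_4) : 'I_4 := ordS i.       (* i + 1 mod 4 *)
Definition prv (i : 'I_4) : 'I_4 := ord_pred i.   (* i - 1 mod 4 *)
Definition i0 : 'I_4 := @inord 3 0.
Definition i1 : 'I_4 := @inord 3 1.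
Definition i2 : 'I_4 := @inord 3 2.
Definition i3 : 'I_4 := @inord 3 3.

(* Edges of the medial graph X: the edge (Q,i) lies in F_Q and joins the      *)
(* midpoints of the sides {c_(i-1),c_i} and {c_i,c_(i+1)} of Q (c = corner Q). *)
(* (By strong regularity each edge of X arises from exactly one (Q,i).)        *)
Definition XE (F : finType) := (F * 'I_4)%type.
(* Oriented edges of X: (e, true) = e oriented from the midpoint of            *)
(* {c_(i-1),c_i} to the midpoint of {c_i,c_(i+1)}; (e, false) = reverse.       *)
Definition OE (F : finType) := (XE F * bool)%type.

Section Surface.
Variables (V F : finType) (corner : F -> 'I_4 -> V) (black : V -> bool).

Definition vset (Q : F) : {set V} := [set corner Q i | i : 'I_4].
(* the j-th side (edge of Lambda) of Q, joining corners j and j+1;            *)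
(* an edge of Lambda is identified with its set of two endpoints, and this    *)
(* set also names the corresponding vertex (midpoint) of X.                   *)
Definition side (Q : F) (j : 'I_4) : {set V} := [set corner Q j; corner Q (nxt j)].

(* two flags (face, corner) at the same vertex v whose faces share an edge    *)
(* of Lambda incident to v                                                    *)
Definition flag_adj : rel (F * 'I_4) := fun f g =>
  (corner f.1 f.2 == corner g.1 g.2) &&
  ((corner f.1 (nxt f.2) == corner g.1 (prv g.2)) ||
   (corner f.1 (prv f.2) == corner g.1 (nxt g.2))).

Definition face_adj : rel F := fun Q Q' =>
  [exists j, exists k, side Q j == side Q' k].

(* (Lambda, black) is a finite strongly regular quadrilateral cellular        *)
(* decomposition of a compact connected oriented surface, with bipartite      *)
(* 1-skeleton and the fixed colouring; faces are oriented counterclockwise.   *)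
Definition quad_surface : Prop :=
  (* each face is a quadrilateral with 4 distinct vertices *)
  (forall Q, injective (corner Q)) /\
  (* colouring b_-, w_-, b_+, w_+ (bipartite 1-skeleton) *)
  (forall Q, [/\ black (corner Q i0), ~~ black (corner Q i1),
                black (corner Q i2) & ~~ black (corner Q i3)]) /\
  (* every vertex is a vertex of some face *)
  (forall v, exists Q i, corner Q i = v) /\
  (* closed surface: every edge of Lambda is a side of exactly two faces *)
  (forall Q j, #|[set f : F * 'I_4 | side f.1 f.2 == side Q j]| = 2%N) /\
  (* coherent orientation: the two faces induce opposite orientations *)
  (forall Q j Q' k, (Q', k) != (Q, j) -> side Q' k = side Q j ->
     corner Q' k = corner Q (nxt j) /\ corner Q' (nxt k) = corner Q j) /\
  (* the star of every vertex is a disk: the faces around v form one cycle *)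
  (forall f g : F * 'I_4, corner f.1 f.2 = corner g.1 g.2 -> connect flag_adj f g) /\
  (* connected *)
  (forall Q Q', connect face_adj Q Q') /\
  (* strongly regular: two distinct faces are disjoint, share exactly one *)
  (* vertex, or share exactly one edge                                    *)
  (forall Q Q', Q != Q' ->
     (#|vset Q :&: vset Q'| <= 1)%N \/
     exists j k, vset Q :&: vset Q' = side Q j /\ side Q' k = side Q j).

(* ---------- the medial graph X and its cellular homology ---------- *)
Definition xsrc (e : XE F) : {set V} := side e.1 (prv e.2).
Definition xtgt (e : XE F) : {set V} := side e.1 e.2.
Definition oe_src (o : OE F) := if o.2 then xsrc o.1 else xtgt o.1.
Definition oe_tgt (o : OE F) := if o.2 then xtgt o.1 else xsrc o.1.

(* closed path on X: a cyclic sequence of consecutive oriented edges *)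
Definition closed_path (P : seq (OE F)) : bool :=
  cycle (fun o1 o2 => oe_tgt o1 == oe_src o2) P.

(* integer 1-chains on X (coefficients w.r.t. the reference orientation) *)
Definition chain := XE F -> int.
Definition chain_of (P : seq (OE F)) : chain := fun e =>
  \sum_(o <- P) (if o.1 == e then (if o.2 then 1 else -1) else 0).
Definition is_cycle (c : chain) : Prop :=
  forall s : {set V},
    \sum_(e : XE F) c e * ((xtgt e == s)%:Z - (xsrc e == s)%:Z) = 0.
(* boundaries of the faces F_Q and F_v of X *)
Definition bdF (Q : F) : chain := fun e => (e.1 == Q)%:Z.
Definition bdV (v : V) : chain := fun e => (corner e.1 e.2 == v)%:Z.
(* homology in H_1(Sigma, Z) = cellular homology of the cell complex X *)
Definition homologous (c d : chain) : Prop :=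
  exists (x : F -> int) (y : V -> int), forall e,
    c e - d e = \sum_(Q : F) x Q * bdF Q e + \sum_(v : V) y v * bdV v e.

(* intersection number of two 1-cycles on X (Sigma oriented by the          *)
(* counterclockwise order of the faces); the double sum is even on cycles.  *)
Definition xint2 (c d : chain) : int :=
  \sum_(Q : F) \sum_(j : 'I_4) (c (Q, j) * d (Q, nxt j) - c (Q, nxt j) * d (Q, j)).
Definition xint (c d : chain) : int := (xint2 c d %/ 2)%Z.

Definition lincomb g (m n : 'I_g -> int) (a b : 'I_g -> chain) : chain :=
  fun e => \sum_(i < g) (m i * a i e + n i * b i e).

(* (a_1..a_g,b_1..b_g), represented by closed paths alpha_i, beta_i on X,   *)
(* is a symplectic basis of H_1(Sigma, Z)                                    *)
Definition symplectic_basis g (alpha beta : 'I_g -> seq (OE F)) : Prop :=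
  let a := fun i => chain_of (alpha i) in
  let b := fun i => chain_of (beta i) in
  [/\ forall i, closed_path (alpha i) && closed_path (beta i),
      forall i j, [/\ xint (a i) (a j) = 0, xint (b i) (b j) = 0
                    & xint (a i) (b j) = (i == j)%:Z],
      (* generating *)
      forall c, is_cycle c -> exists m n, homologous c (lincomb m n a b) &
      (* free *)
      forall m n, homologous (lincomb m n a b) (fun _ => 0) ->
        forall i, m i = 0 /\ n i = 0].

(* ---------- the involution tau ---------- *)
Variables (tau : V -> V) (tauF : F -> F).

(* tau is an involutive automorphism of Lambda mapping faces to faces        *)
(* (Q to tauF Q) and reversing orientation: the counterclockwise boundary of *)
(* Q is mapped onto the clockwise boundary of tauF Q.                        *)
Definition antihol_involution : Prop :=
  involutive tau /\
  forall Q, exists k : 'I_4, forall i : 'I_4, corner (tauF Q) (k - i) = tau (corner Q i).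

(* action of tau on 1-chains of X *)
Definition tau_chain (c : chain) : chain := fun e' =>
  \sum_(e : XE F | (tauF e.1 == e'.1) && (tau (corner e.1 e.2) == corner e'.1 e'.2))
     (if tau @: xsrc e == xsrc e' then c e else - c e).

Variable R : realType.
Variable rho : F -> R[i].

Definition type1 : Prop :=
  (forall v, black (tau v) = black v) /\ forall Q, rho (tauF Q) = (rho Q)^*.
Definition type2 : Prop :=
  (forall v, black (tau v) = ~~ black v) /\ forall Q, rho (tauF Q) = ((rho Q)^*)^-1.

(* ---------- discrete one-forms ---------- *)
(* a discrete one-form is given by its values on the reference orientations *)
Definition form := XE F -> R[i].
Definition oval (w : form) (o : OE F) : R[i] := if o.2 then w o.1 else - w o.1.

(* black edges of X: those cutting off a white corner (joining midpoints of *)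
(* uv and vw with u, w black)                                              *)
Definition blackE (e : XE F) : bool := ~~ black (corner e.1 e.2).

(* type Diamond: equal values on the two black edges of F_Q oriented from   *)
(* the b_- side to the b_+ side, and on the two white edges oriented from   *)
(* the w_- side to the w_+ side.                                            *)
Definition diamond (w : form) : Prop := forall Q,
  (* mid(b_- w_-) -> mid(w_- b_+)  and  mid(b_- w_+) -> mid(w_+ b_+) *)
  oval w ((Q, i1), true) = oval w ((Q, i3), false) /\
  (* mid(w_- b_-) -> mid(b_- w_+)  and  mid(w_- b_+) -> mid(b_+ w_+) *)
  oval w ((Q, i0), false) = oval w ((Q, i2), true).

Definition chain_int (c : chain) (w : form) : R[i] :=
  \sum_(e : XE F) (c e)%:~R * w e.
Definition closed_form (w : form) : Prop :=
  (forall Q, chain_int (bdF Q) w = 0) /\ (forall v, chain_int (bdV v) w = 0).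

(* df on the edge from mid(uv) to mid(vw):  (f w - f u) / 2 *)
Definition dfun (f : V -> R[i]) (e : XE F) : R[i] :=
  (f (corner e.1 (nxt e.2)) - f (corner e.1 (prv e.2))) / 2.
Definition holo_on (Q : F) (f : V -> R[i]) : Prop :=
  f (corner Q i3) - f (corner Q i1) = 'i * rho Q * (f (corner Q i2) - f (corner Q i0)).

Definition holo_differential (w : form) : Prop :=
  [/\ closed_form w, diamond w &
      forall Q, exists f : V -> R[i], holo_on Q f /\ forall i, w (Q, i) = dfun f (Q, i)].

(* black period 2 \int_{BP} w and white period 2 \int_{WP} w *)
Definition bper (w : form) (P : seq (OE F)) : R[i] :=
  2 * \sum_(o <- P | blackE o.1) oval w o.
Definition wper (w : form) (P : seq (OE F)) : R[i] :=
  2 * \sum_(o <- P | ~~ blackE o.1) oval w o.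

End Surface.

(* Main.v *)
(** A discrete holomorphic differential is determined by its black and white a-periods. The
    involution tau reverses the orientation of X, so [w |-> conj (tau^* w)] preserves discrete
    holomorphic differentials; as tau fixes the a-cycles, it fixes each omega^B_k, omega^W_k in
    type 1 and exchanges the two families in type 2. Evaluating on
    [tau b_j = \sum_i h_ij a_i - b_j] then gives the relations between the periods.

    For the uniqueness, [whiteblack c d] counts the crossings of the white edges of [c] with
    the black edges of [d]. On cycles it is antisymmetric, hence equals the intersection number.
    If [p] is a closed form carried by the black edges with vanishing a-periods, subtracting the
    combination of the forms [whiteblack a_i] with the b-periods of [p] as coefficients makes
    all its periods vanish; the difference is then exact, so that [p] is orthogonal to every
    closed form carried by the white edges with vanishing a-periods. Applied to the conjugate
    of the black part and to the white part of a differential, this says that its energy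
    [\sum_Q 'Re (rho Q) * `|w (Q, i1)| ^+ 2] is zero. *)

Require Import Defs.
From HB Require Import structures.
From mathcomp Require Import all_boot all_order all_algebra complex.
From mathcomp Require Import reals.
From mathcomp Require Import ring.
Set Implicit Arguments.
Unset Strict Implicit.
Unset Printing Implicit Defensive.
Import Order.TTheory GRing.Theory Num.Theory.
Local Open Scope ring_scope.

(** * Corner indices modulo 4 and sums over the edges of X *)

Lemma ord4_ind (P : 'I_4 -> Prop) : P i0 -> P i1 -> P i2 -> P i3 -> forall i, P i.
Proof.
move=> P0 P1 P2 P3 [[|[|[|[|m]]]] Hm] //.
- by rewrite (_ : Ordinal Hm = i0) //; apply: val_inj; rewrite /= inordK.
- by rewrite (_ : Ordinal Hm = i1) //; apply: val_inj; rewrite /= inordK.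
- by rewrite (_ : Ordinal Hm = i2) //; apply: val_inj; rewrite /= inordK.
- by rewrite (_ : Ordinal Hm = i3) //; apply: val_inj; rewrite /= inordK.
Qed.

Lemma big_ord4 (M : nmodType) (G : 'I_4 -> M) :
  \sum_(i < 4) G i = G i0 + G i1 + G i2 + G i3.
Proof.
rewrite !big_ord_recl big_ord0 addr0 !addrA.
by congr (G _ + G _ + G _ + G _); apply: val_inj; rewrite /= inordK.
Qed.

Lemma nxtE : ((nxt i0 = i1) * (nxt i1 = i2) * (nxt i2 = i3) * (nxt i3 = i0))%type.
Proof. by do !split; apply: val_inj; rewrite /= !inordK. Qed.

Lemma prvE : ((prv i0 = i3) * (prv i1 = i0) * (prv i2 = i1) * (prv i3 = i2))%type.
Proof. by do !split; apply: val_inj; rewrite /= !inordK. Qed.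

Lemma oddi : ((odd i0 = false) * (odd i1 = true) * (odd i2 = false) * (odd i3 = true))%type.
Proof. by rewrite !inordK. Qed.

Lemma nxtK : cancel nxt prv. Proof. exact: ordSK. Qed.
Lemma prvK : cancel prv nxt. Proof. exact: ord_predK. Qed.

Lemma odd_nxt i : odd (nxt i) = ~~ odd i.
Proof. by elim/ord4_ind: i; rewrite !nxtE !oddi. Qed.

Lemma sub4E : ((i0 - i0 = i0 :> 'I_4) * (i0 - i1 = i3 :> 'I_4) * (i0 - i2 = i2 :> 'I_4) * (i0 - i3 = i1
  :> 'I_4) * (i1 - i0 = i1 :> 'I_4) * (i1 - i1 = i0 :> 'I_4) * (i1 - i2 = i3 :> 'I_4) * (i1
  - i3 = i2 :> 'I_4) * (i2 - i0 = i2 :> 'I_4) * (i2 - i1 = i1 :> 'I_4) * (i2 - i2 = i0 :>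
  'I_4) * (i2 - i3 = i3 :> 'I_4) * (i3 - i0 = i3 :> 'I_4) * (i3 - i1 = i2 :> 'I_4) * (i3 -
  i2 = i1 :> 'I_4) * (i3 - i3 = i0 :> 'I_4))%type.
Proof. by do !split; apply: val_inj; rewrite /= !inordK. Qed.

Lemma subr_nxt (k i : 'I_4) : k - nxt i = prv (k - i).
Proof.
by elim/ord4_ind: k; elim/ord4_ind: i; rewrite nxtE; apply: val_inj;
  rewrite /= !inordK.
Qed.

Lemma subr_prv (k i : 'I_4) : k - prv i = nxt (k - i).
Proof. by rewrite -{2}(prvK i) subr_nxt prvK. Qed.

Lemma odd_subI4 (k i : 'I_4) : odd (k - i)%R = odd k (+) odd i.
Proof.
by elim/ord4_ind: k; elim/ord4_ind: i; rewrite /= !inordK.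
Qed.

Lemma sum_XE (F : finType) (M : nmodType) (G : XE F -> M) :
  \sum_e G e = \sum_Q (G (Q, i0) + G (Q, i1) + G (Q, i2) + G (Q, i3)).
Proof.
rewrite (eq_bigr (fun e => G (e.1, e.2))); last by case.
rewrite -(pair_bigA _ (fun Q i => G (Q, i))).
by apply: eq_bigr => Q _; rewrite big_ord4.
Qed.

Lemma sum_shift (F : finType) (M : nmodType) (G : XE F -> M) :
  \sum_e G e = \sum_e G (e.1, nxt e.2).
Proof.
rewrite (reindex (fun e : XE F => (e.1, nxt e.2))) //=.
exists (fun e : XE F => (e.1, prv e.2)) => -[Q i] _ /=.
  by rewrite nxtK.
by rewrite prvK.
Qed.

(** Descends functions of flags to midpoints and to vertices; the value 0 off the image of [side] is
    arbitrary. *)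
Lemma factor_through (T S : finType) (K : nmodType) (side : T -> S) (G : T -> K) :
  (forall f g, side f = side g -> G f = G g) ->
  exists phi : S -> K, forall f, phi (side f) = G f.
Proof.
move=> eqG; exists (fun s => if [pick f | side f == s] is Some f then G f else 0).
move=> f; case: pickP => [g /eqP/eqG //|/(_ f)]; by rewrite eqxx.
Qed.

(** * Cycles on X, the crossing pairing, and primitives of forms without periods *)

Section Surface.
Variables (V F : finType) (corner : F -> 'I_4 -> V) (black : V -> bool).
Hypothesis qs : quad_surface corner black.

Lemma corner_inj Q : injective (corner Q).
Proof. by case: qs. Qed.

Lemma black_corner Q i : black (corner Q i) = ~~ odd i.
Proof.
case: qs => _ [/(_ Q) [b0 /negbTE b1 b2 /negbTE b3] _].
by elim/ord4_ind: i; rewrite oddi ?b0 ?b1 ?b2 ?b3.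
Qed.

Lemma blackE_odd (e : XE F) : blackE corner black e = odd e.2.
Proof. by rewrite /blackE black_corner negbK. Qed.

(** Strong regularity lets distinct faces share at most two vertices, never all four. *)
Lemma vset_inj : injective (vset corner).
Proof.
move=> Q Q' eqv; apply/eqP; apply: contraT => neqQ.
case: qs => _ [_ [_ [_ [_ [_ [_ sr]]]]]].
have c4 : #|vset corner Q| = 4.
  by rewrite card_imset ?card_ord //; exact: corner_inj.
case: (sr _ _ neqQ); rewrite -eqv setIid; first by rewrite c4.
move=> [j [k [eqs _]]]; move: c4; rewrite eqs /side.
by move=> c4; have := cards2 (corner Q j) (corner Q (nxt j)); rewrite c4; case: (_ != _).
Qed.

(** [f'] is the same edge of the quadrangulation seen from its other side, traversed backwards
    because orientations are coherent. *)
Lemma twin f : exists f' : F * 'I_4, [/\ f' != f,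
  forall h, (side corner h.1 h.2 == side corner f.1 f.2) = (h == f) || (h == f'),
  corner f'.1 f'.2 = corner f.1 (nxt f.2) & corner f'.1 (nxt f'.2) = corner f.1 f.2].
Proof.
case: qs => _ [_ [_ [s2 [co _]]]].
case: f => Q j /=; have /eqP/cards2P[x [y [nxy eqS]]] := s2 Q j.
have memS h : (side corner h.1 h.2 == side corner Q j) = (h == x) || (h == y).
  by move/setP/(_ h): eqS; rewrite !inE.
have [f' [nf' memf']] : exists f', f' != (Q, j) /\
    forall h, (side corner h.1 h.2 == side corner Q j) = (h == (Q, j)) || (h == f').
  have := memS (Q, j); rewrite eqxx => /esym/orP[] /eqP E; [exists y | exists x].
    by rewrite E eq_sym; split => // h; rewrite memS.
  by rewrite E; split => // h; rewrite memS orbC.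
have := memf' f'; rewrite eqxx orbT; case: f' nf' memf' => Q' k nf' memf' /= /eqP Es.
by case: (co _ _ _ _ nf' Es) => e1 e2; exists (Q', k).
Qed.

Lemma sum_twin f f' (M : nmodType) (G : F * 'I_4 -> M) : f' != f ->
  (forall h, (side corner h.1 h.2 == side corner f.1 f.2) = (h == f) || (h == f')) ->
  \sum_(h | side corner h.1 h.2 == side corner f.1 f.2) G h = G f + G f'.
Proof.
move=> nf mem; rewrite (bigD1 f) /=; last by rewrite mem eqxx.
rewrite (bigD1 f') /=; last by rewrite mem eqxx orbT nf.
rewrite big1 ?addr0 // => h; rewrite mem.
by case: (h =P f) => //= _; case: (h =P f').
Qed.

Definition bdry (c : chain F) (s : {set V}) : int :=
  \sum_(e : XE F) c e * ((xtgt corner e == s)%:Z - (xsrc corner e == s)%:Z).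

(** Within a face the midpoint of side [i] ends edge [i] and starts edge [nxt i]. *)
Lemma bdryE c s :
  bdry c s = \sum_(e | side corner e.1 e.2 == s) (c e - c (e.1, nxt e.2)).
Proof.
rewrite /bdry; under eq_bigr do rewrite mulrBr.
rewrite sumrB [X in _ - X]sum_shift -sumrB [RHS]big_mkcond /=.
apply: eq_bigr => e _; rewrite /xsrc /xtgt /= nxtK.
by case: (_ == s); rewrite ?mulr1 ?mulr0 ?subr0.
Qed.

Lemma exact_on_cycle (K : pzRingType) (phi : {set V} -> K) c : is_cycle corner c ->
  \sum_e (c e)%:~R * (phi (xtgt corner e) - phi (xsrc corner e)) = 0.
Proof.
move=> cyc.
have ev s : phi s = \sum_u (s == u)%:~R * phi u.
  rewrite (bigD1 s) //= eqxx mul1r big1 ?addr0 // => u /negbTE.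
  by rewrite eq_sym => ->; rewrite mul0r.
under eq_bigr => e _ do rewrite (ev (xtgt corner e)) (ev (xsrc corner e)) -sumrB mulr_sumr.
rewrite exchange_big big1 //= => u _.
rewrite -[RHS](mul0r (phi u)) -[X in _ = X * _](rmorph0 intr) -(cyc u) rmorph_sum mulr_suml.
by apply: eq_bigr => e _; rewrite rmorphM rmorphB /= -mulrBl mulrA.
Qed.

Lemma cycle_of_path P : closed_path corner P -> is_cycle corner (chain_of P).
Proof.
move=> cP s.
have -> : \sum_e chain_of P e * ((xtgt corner e == s)%:Z - (xsrc corner e == s)%:Z)
  = \sum_(o <- P) ((oe_tgt corner o == s)%:Z - (oe_src corner o == s)%:Z).
  under eq_bigr do rewrite /chain_of mulr_suml.
  rewrite exchange_big; apply: eq_bigr => -[e b] _ /=.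
  rewrite (bigD1 e) //= eqxx big1 ?addr0; last first.
    by move=> e' /negbTE; rewrite eq_sym => ->; rewrite mul0r.
  by case: b; rewrite /oe_tgt /oe_src /= ?mul1r // mulN1r opprB.
case: P cP => [|x p]; first by rewrite big_nil.
rewrite /closed_path /= rcons_path => /andP[pth /eqP lst].
set G := fun u => (u == s)%:Z.
suff -> : \sum_(o <- x :: p) ((oe_tgt corner o == s)%:Z - (oe_src corner o == s)%:Z) =
   G (oe_tgt corner (last x p)) - G (oe_src corner x) by rewrite lst subrr.
elim: p x {lst} pth => [|y p IH] x /=; first by rewrite big_seq1.
case/andP=> /eqP xy /IH E; rewrite big_cons E -xy /G; ring.
Qed.

(** The two flags at a midpoint list its endpoints in opposite orders, so their contributions
    cancel. *)
Lemma cycle_bdV v : is_cycle corner (bdV corner v).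
Proof.
move=> s; rewrite -/(bdry _ s) bdryE.
have [f /eqP <-|none] := pickP (fun f : F * 'I_4 => side corner f.1 f.2 == s); last first.
  by rewrite big1 // => e; rewrite none.
have [f' [nf mem e1 e2]] := twin f.
by rewrite (sum_twin _ nf mem) /bdV /= e1 e2; ring.
Qed.

(* On a cycle [c] the flow [c f - c (f.1, nxt f.2)] left at a midpoint by one adjacent face is
   absorbed by the other one, in which the side has the opposite parity. *)
Lemma cycle_potential c : is_cycle corner c -> exists phi : {set V} -> int,
  forall f, phi (side corner f.1 f.2) = (-1) ^+ odd f.2 * (c f - c (f.1, nxt f.2)).
Proof.
move=> cyc; apply: factor_through => f g eqs.
have [f' [nf mem e1 e2]] := twin f.
have := mem g; rewrite eqs eqxx => /esym/orP[] /eqP-> //.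
have oddf : odd f'.2 = ~~ odd f.2.
  by apply: negb_inj; rewrite -(black_corner f'.1 f'.2) e1 black_corner odd_nxt.
have := cyc (side corner f.1 f.2); rewrite -/(bdry _ _) bdryE (sum_twin _ nf mem).
move=> /eqP; rewrite addr_eq0 => /eqP ->; rewrite oddf signrN; ring.
Qed.

Definition whiteblack (c d : chain F) : int :=
  \sum_Q (c (Q, i0) - c (Q, i2)) * (d (Q, i1) - d (Q, i3)).

(** Up to sign, [whiteblack c d + whiteblack d c] sums over [d] the increments of the potential of
    [c], which gives zero on a cycle. *)
Lemma whiteblack_anti c d : is_cycle corner c -> is_cycle corner d ->
  whiteblack c d = - whiteblack d c.
Proof.
move=> cc cd; apply/eqP; rewrite -addr_eq0 -oppr_eq0; apply/eqP.
have [phi phiE] := cycle_potential cc.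
rewrite -(exact_on_cycle phi cd) /whiteblack -big_split /= sum_XE -sumrN.
apply: eq_bigr => Q _; rewrite !intz /xtgt /xsrc /= !prvE.
have E j := phiE (Q, j); rewrite !E /= !nxtE !oddi /=; ring.
Qed.

(** [xint2 c d] expands to [whiteblack c d - whiteblack d c]; by antisymmetry the halving in [xint]
    is exact. *)
Lemma xint_whiteblack c d : is_cycle corner c -> is_cycle corner d ->
  xint c d = whiteblack c d.
Proof.
move=> cc cd; rewrite /xint (_ : xint2 c d = whiteblack c d * 2) ?mulzK //.
rewrite mulr_natr mulr2n {2}(whiteblack_anti cc cd) /whiteblack -sumrB.
by apply: eq_bigr => Q _; rewrite big_ord4 !nxtE; ring.
Qed.

Definition edge_rel : rel {set V} := fun s t =>
  [exists e : XE F, ((xsrc corner e == s) && (xtgt corner e == t)) ||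
                    ((xsrc corner e == t) && (xtgt corner e == s))].

Lemma edge_rel_sym : symmetric edge_rel.
Proof.
by move=> s t; apply/existsP/existsP => -[e He]; exists e; rewrite orbC.
Qed.

Lemma bdryD c d s : bdry (fun e => c e + d e) s = bdry c s + bdry d s.
Proof. by rewrite -big_split; apply: eq_bigr => e _; rewrite mulrDl. Qed.

Lemma bdryN c s : bdry (fun e => - c e) s = - bdry c s.
Proof. by rewrite -sumrN; apply: eq_bigr => e _; rewrite mulNr. Qed.

Definition edge_chain (e : XE F) : chain F := fun e' => (e' == e)%:Z.

Lemma bdry_edge e s :
  bdry (edge_chain e) s = (xtgt corner e == s)%:Z - (xsrc corner e == s)%:Z.
Proof.
rewrite /bdry (bigD1 e) //= /edge_chain eqxx mul1r big1 ?addr0 // => e' /negbTE ->.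
by rewrite mul0r.
Qed.

Lemma connect_chain s t : connect edge_rel s t -> exists c : chain F,
  forall u, bdry c u = (t == u)%:Z - (s == u)%:Z.
Proof.
case/connectP=> p; elim: p s => [|x p IH] s /=.
  move=> _ ->; exists (fun _ => 0) => u; rewrite subrr.
  by apply: big1 => e _; rewrite mul0r.
case/andP=> /existsP[e He] pth lst; have [c cE] := IH _ pth lst.
case/orP: He => /andP[/eqP E1 /eqP E2].
  exists (fun e' => edge_chain e e' + c e') => u.
  by rewrite bdryD bdry_edge cE E1 E2; ring.
exists (fun e' => - edge_chain e e' + c e') => u.
by rewrite bdryD bdryN bdry_edge cE E1 E2; ring.
Qed.

Variable R : realType.
Implicit Types w : XE F -> R[i].

Lemma chain_intD c d w :
  chain_int (fun e => c e + d e) w = chain_int c w + chain_int d w.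
Proof. by rewrite -big_split; apply: eq_bigr => e _; rewrite rmorphD mulrDl. Qed.

Lemma chain_intN c w : chain_int (fun e => - c e) w = - chain_int c w.
Proof. by rewrite -sumrN; apply: eq_bigr => e _; rewrite rmorphN mulNr. Qed.

Lemma chain_intZ n c w : chain_int (fun e => n * c e) w = n%:~R * chain_int c w.
Proof. by rewrite mulr_sumr; apply: eq_bigr => e _; rewrite rmorphM mulrA. Qed.

Lemma chain_int_sum (I : finType) (c : I -> chain F) w :
  chain_int (fun e => \sum_i c i e) w = \sum_i chain_int (c i) w.
Proof.
rewrite exchange_big; apply: eq_bigr => e _ /=.
by rewrite rmorph_sum mulr_suml.
Qed.

Lemma eq_chain_int c d w : c =1 d -> chain_int c w = chain_int d w.
Proof. by move=> E; apply: eq_bigr => e _; rewrite E. Qed.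

Lemma chain_int_edge e w : chain_int (edge_chain e) w = w e.
Proof.
rewrite /chain_int (bigD1 e) //= /edge_chain eqxx mul1r big1 ?addr0 // => e' /negbTE ->.
by rewrite mul0r.
Qed.

Lemma homologous_int c d w : closed_form corner w -> homologous corner c d ->
  chain_int c w = chain_int d w.
Proof.
move=> [wF wV] [x [y E]].
have /eq_chain_int-> : c =1 fun e => d e + (\sum_Q x Q * bdF Q e + \sum_v y v * bdV corner v e).
  by move=> e; rewrite -E; ring.
rewrite !chain_intD !chain_int_sum !big1 ?addr0 // => [v|Q] _.
  by rewrite chain_intZ wV mulr0.
by rewrite chain_intZ wF mulr0.
Qed.

Lemma exact_form w : (forall c, is_cycle corner c -> chain_int c w = 0) ->
  exists f : {set V} -> R[i], forall e, w e = f (xtgt corner e) - f (xsrc corner e).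
Proof.
move=> w0; have sym := sym_connect_sym edge_rel_sym.
have /fin_all_exists[c cE] s := connect_chain (connect_root edge_rel s).
(* [c s] runs from [s] to the root of its component, so this is the integral from the root to
   [s]. *)
exists (fun s => - chain_int (c s) w) => e.
have rt : fingraph.root edge_rel (xsrc corner e) = fingraph.root edge_rel (xtgt corner e).
  apply/eqP; rewrite root_connect //; apply: connect1; apply/existsP; exists e.
  by rewrite !eqxx.
set s := xsrc corner e; set t := xtgt corner e.
(* The loop from [s] along [e] to [t], on to the common root and back to [s]. *)
have cyc : is_cycle corner (fun e' => c t e' + edge_chain e e' - c s e').
  move=> u; rewrite -/(bdry _ u) (bdryD _ (fun e' => - c s e')) bdryN bdryD bdry_edge !cE.
  by rewrite rt; ring.
have := w0 _ cyc.
rewrite (chain_intD _ (fun e' => - c s e')) chain_intN chain_intD chain_int_edge.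
by move=> /eqP; rewrite subr_eq0 => /eqP <-; ring.
Qed.

End Surface.

(** * Black and white periods, and uniqueness of differentials with given a-periods *)

Section Periods.
Variables (R : realType) (V F : finType) (corner : F -> 'I_4 -> V) (black : V -> bool).
Hypothesis qs : quad_surface corner black.
Implicit Types w p q : XE F -> R[i].

(* The edge of [X] at corner [i] of a face is black iff [i] is odd, so [part true w] and
   [part false w] are the restrictions of [w] to the black and to the white edges. *)
Definition part (b : bool) w : XE F -> R[i] := fun e => if odd e.2 == b then w e else 0.

(** Reference orientations run around the face, so opposite edges carry opposite values; the last
    clause is the discrete Cauchy-Riemann equation with [f] eliminated. *)
Definition local_holo (rho : F -> R[i]) w := forall Q,
  [/\ w (Q, i3) = - w (Q, i1), w (Q, i0) = - w (Q, i2) & w (Q, i2) = 'i * rho Q * w (Q, i1)].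

Lemma holo_differential_local rho w : holo_differential corner rho w ->
  closed_form corner w /\ local_holo rho w.
Proof.
case=> cl dia loc; split=> // Q.
have [d1 d2] := dia Q; move: d1 d2; rewrite /oval /= => d1 d2; split=> //.
- by rewrite d1 opprK.
- by rewrite -d2 opprK.
case: (loc Q) => f [h E]; rewrite !E /dfun /= !nxtE !prvE h; ring.
Qed.

Definition period (b : bool) w P : R[i] := 2 * chain_int (chain_of P) (part b w).

Lemma chain_int_path P w : chain_int (chain_of P) w = \sum_(o <- P) oval w o.
Proof.
rewrite /chain_int; under eq_bigr do rewrite /chain_of rmorph_sum mulr_suml.
rewrite exchange_big; apply: eq_bigr => -[e b] _ /=.
rewrite (bigD1 e) //= eqxx big1 ?addr0.
  by case: b; rewrite /oval /= ?mul1r ?mulN1r.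
by move=> e' /negbTE; rewrite eq_sym => ->; rewrite mul0r.
Qed.

Lemma bper_period w P : bper corner black w P = period true w P.
Proof.
rewrite /bper /period chain_int_path big_mkcond /=; congr (2 * _).
apply: eq_bigr => -[e b] _; rewrite (blackE_odd qs) /oval /part /= eqb_id.
by case: odd; case: b; rewrite ?oppr0.
Qed.

Lemma wper_period w P : wper corner black w P = period false w P.
Proof.
rewrite /wper /period chain_int_path big_mkcond /=; congr (2 * _).
apply: eq_bigr => -[e b] _; rewrite (blackE_odd qs) /oval /part /= eqbF_neg.
by case: odd; case: b; rewrite ?oppr0.
Qed.

Lemma chain_int_bdF Q w :
  chain_int (bdF Q) w = w (Q, i0) + w (Q, i1) + w (Q, i2) + w (Q, i3).
Proof.
rewrite /chain_int sum_XE (bigD1 Q) //= /bdF /= eqxx !mul1r big1 ?addr0 //.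
by move=> Q' /negbTE ->; rewrite !mul0r !addr0.
Qed.

(** Opposite edges cancel around a face; the edges around a vertex all have one color, so
    restriction keeps the whole sum or kills it. *)
Lemma part_closed rho b w : closed_form corner w -> local_holo rho w ->
  closed_form corner (part b w).
Proof.
move=> [wF wV] loc; split=> [Q|v].
  rewrite chain_int_bdF /part /= !oddi; have [-> -> _] := loc Q.
  by case: b => /=; ring.
have [E|E] := boolP (black v == ~~ b).
  rewrite -(wV v); apply: eq_bigr => e _; rewrite /bdV /part.
  case: (corner e.1 e.2 =P v) => [ev|]; last by rewrite !mul0r.
  move/eqP: E; rewrite -ev (black_corner qs) => /negb_inj ->; by rewrite eqxx.
apply: big1 => e _; rewrite /bdV /part.
case: (corner e.1 e.2 =P v) => [ev|]; last by rewrite mul0r.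
move: E; rewrite -ev (black_corner qs) (inj_eq negb_inj) => /negbTE ->.
by rewrite mulr0.
Qed.

Lemma closed_formB w w' : closed_form corner w -> closed_form corner w' ->
  closed_form corner (fun e => w e - w' e).
Proof.
have lin c : chain_int c (fun e => w e - w' e) = chain_int c w - chain_int c w'.
  by rewrite -sumrB; apply: eq_bigr => e _; rewrite mulrBr.
by move=> [wF wV] [wF' wV']; split=> [Q|v]; rewrite lin ?wF ?wF' ?wV ?wV' subrr.
Qed.

(** A discrete Poincare dual of the white part of [c], carried by the black edges. *)
Definition white_dual (c : chain F) : XE F -> R[i] := fun e =>
  if odd e.2 then (c (e.1, prv e.2) - c (e.1, nxt e.2))%:~R else 0.

Lemma white_dual_int c d : chain_int d (white_dual c) = (whiteblack c d)%:~R.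
Proof.
rewrite /chain_int sum_XE /whiteblack rmorph_sum; apply: eq_bigr => Q _ /=.
by rewrite /white_dual /= !oddi !prvE !nxtE rmorphM !rmorphB /=; ring.
Qed.

(** The boundary around a black vertex has only white edges and pairs to zero; for a white vertex,
    antisymmetry first swaps the arguments. *)
Lemma white_dual_closed c : is_cycle corner c -> closed_form corner (white_dual c).
Proof.
move=> cyc; split=> [Q|v].
  by rewrite chain_int_bdF /white_dual /= !oddi !prvE !nxtE !rmorphB /=; ring.
rewrite white_dual_int.
case E : (black v); last first.
  rewrite (whiteblack_anti qs cyc (cycle_bdV qs v)) /whiteblack big1 ?oppr0 // => Q _.
  have n (i : 'I_4) : ~~ odd i -> corner Q i == v = false.
    by move=> oi; apply/eqP => ev; move: E; rewrite -ev (black_corner qs) oi.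
  by rewrite /bdV /= !n ?oddi // subrr mul0r.
rewrite /whiteblack big1 // => Q _.
have n (i : 'I_4) : odd i -> corner Q i == v = false.
  by move=> oi; apply/eqP => ev; move: E; rewrite -ev (black_corner qs) oi.
by rewrite /bdV /= !n ?oddi // subrr mulr0.
Qed.

(** The hypothesis equates [f] on the two sides meeting at a black corner; as the faces around a
    vertex form one cycle, [f] is constant around each black vertex. *)
Lemma black_potential (f : {set V} -> R[i]) :
  (forall Q, f (side corner Q i0) = f (side corner Q i3) /\
             f (side corner Q i2) = f (side corner Q i1)) ->
  exists g : V -> R[i], forall Q, f (side corner Q i0) = g (corner Q i0) /\
                                  f (side corner Q i1) = g (corner Q i2).
Proof.
move=> fE.
have fprv Q i : black (corner Q i) -> f (side corner Q i) = f (side corner Q (prv i)).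
  have [E0 E2] := fE Q; rewrite (black_corner qs).
  by elim/ord4_ind: i; rewrite !oddi ?prvE.
pose G (e : F * 'I_4) := if black (corner e.1 e.2) then f (side corner e.1 e.2) else 0.
have Gadj d e : flag_adj corner d e -> G d = G e.
  case/andP=> /eqP ec ac; rewrite /G -ec; case: ifP => // bl.
  have bl' : black (corner e.1 e.2) by rewrite -ec.
  case/orP: ac => /eqP ac.
    by rewrite (fprv e.1 e.2) // /side prvK ac ec setUC.
  by rewrite (fprv d.1 d.2) // /side prvK ac ec setUC.
have [|g gE] := @factor_through _ V _ (fun e => corner e.1 e.2) G.
  case: qs => _ [_ [_ [_ [_ [star _]]]]] d e /star /connectP[p].
  elim: p d => [|x p IH] d /=; first by move=> _ ->.
  by case/andP=> /Gadj -> pth; exact: IH.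
exists g => Q; have := gE (Q, i2); have := gE (Q, i0).
rewrite /G /= !(black_corner qs) !oddi /= => -> ->.
by split=> //; case: (fE Q).
Qed.

(** A Riemann bilinear relation: the exact part of [p] is summed by parts, and the rest pairs with
    [q] to give a-periods of [q]. *)
Lemma bilinear_vanish g (alpha beta : 'I_g -> seq (OE F)) p q :
  symplectic_basis corner alpha beta ->
  closed_form corner p -> closed_form corner q ->
  (forall Q, [/\ p (Q, i0) = 0, p (Q, i2) = 0 & p (Q, i3) = - p (Q, i1)]) ->
  (forall Q, [/\ q (Q, i1) = 0, q (Q, i3) = 0 & q (Q, i0) = - q (Q, i2)]) ->
  (forall i, chain_int (chain_of (alpha i)) p = 0) ->
  (forall i, chain_int (chain_of (alpha i)) q = 0) ->
  \sum_Q p (Q, i1) * q (Q, i2) = 0.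
Proof.
move=> [cp sy gen _] pc qc pE qE pa qa.
set a := fun i => chain_of (alpha i); set b := fun i => chain_of (beta i).
have ca i : is_cycle corner (a i) by apply: cycle_of_path; case/andP: (cp i).
have cb i : is_cycle corner (b i) by apply: cycle_of_path; case/andP: (cp i).
(* Since [a i] meets only [b i], once and positively, [r] has the same periods as [p]. *)
pose r : XE F -> R[i] := fun e => \sum_i chain_int (b i) p * white_dual (a i) e.
have rint c : chain_int c r = \sum_i chain_int (b i) p * (whiteblack (a i) c)%:~R.
  rewrite /chain_int /r; under eq_bigr do rewrite mulr_sumr.
  rewrite exchange_big; apply: eq_bigr => i _ /=.
  rewrite -white_dual_int /chain_int mulr_sumr; apply: eq_bigr => e _; ring.
have rc : closed_form corner r.
  split=> [Q|v]; rewrite rint big1 // => i _; rewrite -white_dual_int.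
    by have [-> _] := white_dual_closed (ca i); rewrite mulr0.
  by have [_ ->] := white_dual_closed (ca i); rewrite mulr0.
pose p' := fun e => p e - r e.
have p'c : closed_form corner p' by exact: closed_formB.
have p'int c : chain_int c p' = chain_int c p - chain_int c r.
  by rewrite -sumrB; apply: eq_bigr => e _; rewrite mulrBr.
have p'a i : chain_int (a i) p' = 0.
  rewrite p'int pa rint big1 ?subrr // => j _.
  have [+ _ _] := sy j i; rewrite (xint_whiteblack qs (ca j) (ca i)) => ->.
  by rewrite mulr0.
have p'b i : chain_int (b i) p' = 0.
  rewrite p'int rint (bigD1 i) //= big1 ?addr0.
    have [_ _ +] := sy i i; rewrite (xint_whiteblack qs (ca i) (cb i)) => ->.
    by rewrite eqxx mulr1 subrr.
  move=> j ji; have [_ _ +] := sy j i.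
  by rewrite (xint_whiteblack qs (ca j) (cb i)) => ->; rewrite (negbTE ji) mulr0.
have [|f fE] := @exact_form _ _ corner _ p'.
  move=> c /gen[m [n]] /(homologous_int p'c) ->.
  rewrite chain_int_sum big1 // => i _.
  by rewrite chain_intD !chain_intZ p'a p'b !mulr0 addr0.
(* Hence [p'] still vanishes on white edges, as [black_potential] requires. *)
have rQ Q : r (Q, i0) = 0 /\ r (Q, i2) = 0.
  by rewrite /r /white_dual /= !oddi; split; apply: big1 => i _; rewrite mulr0.
have [|h hE] := @black_potential f.
  move=> Q; have := fE (Q, i2); have := fE (Q, i0).
  rewrite /xtgt /xsrc /= !prvE /p'.
  have [-> -> _] := pE Q; have [-> ->] := rQ Q; rewrite subrr.
  by move=> /esym/eqP; rewrite subr_eq0 => /eqP -> /esym/eqP; rewrite subr_eq0 => /eqP ->.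
have p'0 : \sum_Q p' (Q, i1) * q (Q, i2) = 0.
  (* Summation by parts: [q (Q, i0) = - q (Q, i2)] turns increments of [h] into corner values, then
     regrouped by vertex. *)
  transitivity (\sum_(e : XE F) h (corner e.1 e.2) * q e).
    rewrite sum_XE; apply: eq_bigr => Q _; have [-> -> ->] := qE Q.
    rewrite fE /xtgt /xsrc /= prvE; have [-> ->] := hE Q; ring.
  rewrite (partition_big (fun e : XE F => corner e.1 e.2) xpredT) //=.
  apply: big1 => v _; have [_ /(_ v) qv] := qc.
  transitivity (h v * chain_int (bdV corner v) q); last by rewrite qv mulr0.
  rewrite mulr_sumr big_mkcond /=.
  apply: eq_bigr => e _; rewrite /bdV.
  by case: eqP => [->|_]; rewrite ?mul1r ?mul0r ?mulr0.
have r0 : \sum_Q r (Q, i1) * q (Q, i2) = 0.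
  under eq_bigr do rewrite mulr_suml; rewrite exchange_big big1 //= => i _.
  transitivity (- chain_int (b i) p * chain_int (a i) q); last by rewrite qa mulr0.
  rewrite [X in _ = _ * X]/chain_int sum_XE mulr_sumr.
  apply: eq_bigr => Q _; have [-> -> ->] := qE Q.
  by rewrite /white_dual /= oddi prvE nxtE rmorphB /=; ring.
rewrite -[RHS]addr0 -[X in X + _]p'0 -[X in _ + X]r0 -big_split /=.
by apply: eq_bigr => Q _; rewrite /p'; ring.
Qed.

Lemma chain_int_conj c w : chain_int c (fun e => (w e)^*) = (chain_int c w)^*.
Proof.
rewrite /chain_int rmorph_sum; apply: eq_bigr => e _.
by rewrite rmorphM rmorph_int.
Qed.

Lemma closed_form_conj w : closed_form corner w -> closed_form corner (fun e => (w e)^*).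
Proof. by move=> [wF wV]; split=> [Q|v]; rewrite chain_int_conj ?wF ?wV conjC0. Qed.

(* Pairing the conjugate of the black part of [w] with its white part gives the energy
   [\sum_Q 'i * rho Q * `|w (Q, i1)| ^+ 2]. *)
Lemma holo_eq0 g (alpha beta : 'I_g -> seq (OE F)) rho w :
  (forall Q, 0 < 'Re (rho Q)) -> symplectic_basis corner alpha beta ->
  closed_form corner w -> local_holo rho w ->
  (forall b j, period b w (alpha j) = 0) -> forall e, w e = 0.
Proof.
move=> rho0 sy wc loc per0.
have pint b j : chain_int (chain_of (alpha j)) (part b w) = 0.
  by move: (per0 b j) => /eqP; rewrite mulf_eq0 pnatr_eq0 => /eqP.
have E : \sum_Q (part true w (Q, i1))^* * part false w (Q, i2) = 0.
  apply: (bilinear_vanish sy (closed_form_conj (part_closed true wc loc))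
    (part_closed false wc loc)) => [Q|Q|j|j] //.
  - by rewrite /part /= !oddi; have [-> _ _] := loc Q; rewrite /= conjC0 rmorphN.
  - by rewrite /part /= !oddi; have [_ -> _] := loc Q.
  - by rewrite chain_int_conj pint conjC0.
have w1 Q : w (Q, i1) = 0.
  (* The factor [- 'i] leaves [rho Q'], whose real part is positive. *)
  have term Q' : 'Re (- 'i * ((part true w (Q', i1))^* * part false w (Q', i2)))
     = 'Re (rho Q') * `|w (Q', i1)| ^+ 2.
    rewrite /part /= !oddi /=; have [_ _ ->] := loc Q'.
    rewrite normCK -ReMr; last by rewrite -normCK rpredX // normr_real.
    congr ('Re _).
    rewrite (_ : - 'i * _ = - ('i ^+ 2) * rho Q' * (w (Q', i1) * (w (Q', i1))^*)); last by ring.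
    by rewrite sqrCi opprK mul1r.
  have {}E : \sum_Q' 'Re (rho Q') * `|w (Q', i1)| ^+ 2 = 0.
    transitivity ('Re (- 'i * \sum_Q (part true w (Q, i1))^* * part false w (Q, i2))).
      by rewrite mulr_sumr raddf_sum; apply: eq_bigr => Q' _; exact: esym (term Q').
    by rewrite E mulr0 raddf0.
  have nn Q' : true -> 0 <= 'Re (rho Q') * `|w (Q', i1)| ^+ 2.
    by move=> _; rewrite mulr_ge0 ?exprn_ge0 // ltW.
  have /eqP : 'Re (rho Q) * `|w (Q, i1)| ^+ 2 = 0 by exact: (psumr_eq0P nn E).
  by rewrite mulf_eq0 gt_eqF //= expf_eq0 /= normr_eq0 => /eqP.
case=> Q i; have [e3 e0 e2] := loc Q.
move: e2; rewrite w1 mulr0 => e2.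
by elim/ord4_ind: i; rewrite ?e3 ?e0 ?e2 ?w1 ?oppr0.
Qed.

End Periods.

(** * Action of tau on chains and forms, with [t] telling whether colors are swapped *)

Section Involution.
Variables (R : realType) (V F : finType) (corner : F -> 'I_4 -> V) (black : V -> bool).
Variables (tau : V -> V) (tauF : F -> F) (k : F -> 'I_4) (t : bool).
Hypothesis qs : quad_surface corner black.
Hypothesis tauK : involutive tau.
Hypothesis corner_tauF : forall Q i, corner (tauF Q) (k Q - i) = tau (corner Q i).
Hypothesis black_tau : forall v, black (tau v) = t (+) black v.
Implicit Types w : XE F -> R[i].

(** Corner 0 is black and goes to corner [k Q] of the image face. *)
Lemma odd_shift Q : odd (k Q) = t.
Proof.
have := black_tau (corner Q 0); rewrite -corner_tauF subr0 !(black_corner qs) /=.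
by case: t; case: odd.
Qed.

(** A face is determined by its vertex set, on which tau acts injectively. *)
Lemma tauF_inj : injective tauF.
Proof.
have vset_tau Q : vset corner (tauF Q) = tau @: vset corner Q.
  apply/setP => v; apply/imsetP/imsetP => [[i _ ->]|[u /imsetP[i _ ->] ->]].
    exists (corner Q (k Q - i)); first exact: imset_f.
    by rewrite -corner_tauF opprB addrC subrK.
  by exists (k Q - i); rewrite ?corner_tauF.
move=> Q Q' E; apply: (vset_inj qs); apply: (imset_inj (inv_inj tauK)).
by rewrite -!vset_tau E.
Qed.

Definition tauX (e : XE F) : XE F := (tauF e.1, k e.1 - e.2).

Lemma corner_tauX e : corner (tauX e).1 (tauX e).2 = tau (corner e.1 e.2).
Proof. exact: corner_tauF. Qed.

Lemma tauX_inj : injective tauX.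
Proof.
move=> [Q i] [Q' i'] [] /tauF_inj <- E; congr (_, _).
by apply: oppr_inj; apply: (addrI (k Q)); apply: val_inj.
Qed.

Lemma tau_chainE c e : tau_chain corner tau tauF c (tauX e) = - c e.
Proof.
rewrite /tau_chain (big_pred1 e) => [|e'].
  case: e => Q i; rewrite /xsrc /tauX /=; case: ifP => // /eqP/setP.
  (* Orientation reversal sends corner [prv i] to corner [nxt (k Q - i)], which is off the source
     side, so only the negative branch occurs. *)
  move/(_ (tau (corner Q (prv i)))).
  rewrite imset_f ?in_set2 ?eqxx // -corner_tauF !(inj_eq (@corner_inj _ _ _ _ qs _)) prvK subr_prv.
  by elim/ord4_ind: (k Q - i); rewrite ?nxtE ?prvE -!val_eqE /= !inordK.
apply/andP/eqP => [[/eqP E1 /eqP E2]|->]; last by rewrite corner_tauX !eqxx.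
case: e' e E1 E2 => [Q' i'] [Q i] /= /tauF_inj <-.
by rewrite corner_tauF => /(inv_inj tauK)/(@corner_inj _ _ _ _ qs) ->.
Qed.

(* The pullback of [w] by tau followed by complex conjugation; the sign appears because tau,
   reversing the boundary of each face, exchanges the two reference orientations of [X]. *)
Definition conj_pull w : XE F -> R[i] := fun e => - (w (tauX e))^*.

Lemma chain_int_tau c w : chain_int c (conj_pull w) = (chain_int (tau_chain corner tau tauF c) w)^*.
Proof.
rewrite [in RHS]/chain_int (reindex_inj tauX_inj) rmorph_sum; apply: eq_bigr => e _.
by rewrite tau_chainE rmorphM rmorph_int rmorphN /conj_pull; ring.
Qed.

(** Transports closedness: tau matches face boundaries up to sign. *)
Lemma tau_chain_int0 c d w : (forall e, c e = d (tauX e)) -> chain_int d w = 0 ->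
  chain_int c (conj_pull w) = 0.
Proof.
move=> E d0; rewrite chain_int_tau -[RHS]conjC0; congr (_ ^* ).
have reE c' : chain_int c' w = \sum_e (c' (tauX e))%:~R * w (tauX e).
  by rewrite /chain_int (reindex_inj tauX_inj).
rewrite -[RHS]oppr0 -d0 !reE -sumrN; apply: eq_bigr => e _.
by rewrite tau_chainE E rmorphN mulNr.
Qed.

Lemma conj_pull_closed w : closed_form corner w -> closed_form corner (conj_pull w).
Proof.
move=> [wF wV]; split=> [Q|v].
  apply: tau_chain_int0 (wF (tauF Q)) => e.
  by rewrite /bdF (inj_eq tauF_inj).
apply: tau_chain_int0 (wV (tau v)) => e.
by rewrite /bdV corner_tauX (inj_eq (inv_inj tauK)).
Qed.

(** Reversal flips the relative sign of the two diagonals, compensating the conjugation of ['i]; if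
    colors swap, the diagonals also trade places and [rho] is inverted. *)
Lemma conj_pull_local rho w : (forall Q, rho Q != 0) ->
  (forall Q, rho (tauF Q) = if t then (rho Q)^*^-1 else (rho Q)^*) ->
  local_holo rho w -> local_holo rho (conj_pull w).
Proof.
move=> rho0 rhoE loc Q; have [e3 e0 e2] := loc (tauF Q).
have conjN (z : R[i]) : (- z)^* = - z^* by exact: rmorphN.
have conjM (y z : R[i]) : (y * z)^* = y^* * z^* by exact: rmorphM.
have rhoC : (rho Q)^*^-1^* = (rho Q)^-1 by rewrite fmorphV; congr (_^-1); exact: conjCK.
have irhoK (z : R[i]) : 'i * rho Q * ('i * (rho Q)^-1 * z) = - z.
  rewrite (_ : _ * _ = 'i ^+ 2 * (rho Q / rho Q) * z); last by ring.
  by rewrite sqrCi divff // mulr1 mulN1r.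
rewrite /conj_pull /tauX /=; move: (odd_shift Q) (rhoE Q); elim/ord4_ind: (k Q); rewrite oddi => <- rhoQ.
all: rewrite !sub4E e3 e0 e2 rhoQ; split.
all: by rewrite ?conjN ?conjM ?conjCi ?rhoC ?conjCK ?mulNr ?mulrN ?irhoK ?opprK.
Qed.

Lemma part_conj_pull b w e : part b (conj_pull w) e = conj_pull (part (t (+) b) w) e.
Proof.
rewrite /part /conj_pull /tauX /= odd_subI4 odd_shift.
by case: t b => [] []; case: odd; rewrite /= ?conjC0 ?oppr0.
Qed.

Lemma period_conj_pull b w P : period b (conj_pull w) P =
  2 * (chain_int (tau_chain corner tau tauF (chain_of P)) (part (t (+) b) w))^*.
Proof.
rewrite -chain_int_tau /period; congr (2 * _).
by apply: eq_bigr => e _; rewrite part_conj_pull.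
Qed.

End Involution.

(** * The period relations *)

Theorem mainTheorem6 (R : realType) (V F : finType) (corner : F -> 'I_4 -> V)
  (black : V -> bool) (rho : F -> R[i]) (tau : V -> V) (tauF : F -> F)
  (g : nat) (alpha beta : 'I_g -> seq (OE F)) (h : 'M[int]_g)
  (omB omW : 'I_g -> XE F -> R[i]) :
  (* discrete real Riemann surface *)
  quad_surface corner black ->
  (forall Q, 0 < 'Re (rho Q)) ->
  antihol_involution corner tau tauF ->
  type1 black tau tauF rho \/ type2 black tau tauF rho ->
  (* symplectic basis with tau(a_i) = a_i, tau(b_i) = sum_j h_ji a_j - b_i *)
  symplectic_basis corner alpha beta ->
  (forall i j, h i j = h j i /\ (h i j = 0 \/ h i j = 1)) ->
  (forall i, homologous corner (tau_chain corner tau tauF (chain_of (alpha i)))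
                               (chain_of (alpha i))) ->
  (forall i, homologous corner (tau_chain corner tau tauF (chain_of (beta i)))
               (fun e => \sum_(j < g) h j i * chain_of (alpha j) e - chain_of (beta i) e)) ->
  (* the normalized discrete holomorphic differentials omega^B_k, omega^W_k *)
  (forall k, holo_differential corner rho (omB k) /\ holo_differential corner rho (omW k)) ->
  (forall j k, bper corner black (omB k) (alpha j) = (j == k)%:R /\
               wper corner black (omB k) (alpha j) = 0) ->
  (forall j k, wper corner black (omW k) (alpha j) = (j == k)%:R /\
               bper corner black (omW k) (alpha j) = 0) ->
  let PiBB := \matrix_(j < g, k < g) bper corner black (omB k) (beta j) in
  let PiWB := \matrix_(j < g, k < g) wper corner black (omB k) (beta j) in
  let PiBW := \matrix_(j < g, k < g) bper corner black (omW k) (beta j) in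
  let PiWW := \matrix_(j < g, k < g) wper corner black (omW k) (beta j) in
  (type1 black tau tauF rho ->
     forall j k, [/\ 2 * 'Re (PiBB j k) = (h j k)%:~R,
                     2 * 'Re (PiWW j k) = (h j k)%:~R,
                     'Re (PiWB j k) = 0 & 'Re (PiBW j k) = 0]) /\
  (type2 black tau tauF rho ->
     forall j k, PiBB j k + (PiWW j k)^* = (h j k)%:~R /\
                 PiWB j k + (PiBW j k)^* = 0).
Proof.
move=> qs rho0 [tauK /fin_all_exists[k kE]] ty sy hP ta tb hol perB perW PiBB PiWB PiBW PiWW.
pose om (b : bool) := if b then omB else omW.
have rho_neq0 Q : rho Q != 0.
  by apply/eqP => E; have := rho0 Q; rewrite E raddf0 ltxx.
have omP b j : closed_form corner (om b j) /\ local_holo rho (om b j).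
  by apply: holo_differential_local; case: (hol j); case: b.
have om_a b c j i : period c (om b j) (alpha i) = ((b == c) && (i == j))%:R.
  case: b c => -[]; rewrite -?(bper_period qs) -?(wper_period qs) /=.
  - by case: (perB i j).
  - by case: (perB i j).
  - by case: (perW i j).
  - by case: (perW i j).
(* Both types at once: tau carries color [c] to [t (+) c] and the family [om b] to
   [om (t (+) b)]. *)
have key t : (forall v, black (tau v) = t (+) black v) ->
  (forall Q, rho (tauF Q) = if t then (rho Q)^*^-1 else (rho Q)^*) ->
  forall b c i j, period (t (+) c) (om (t (+) b) j) (beta i) + (period c (om b j) (beta i))^* =
    if b == c then (h i j)%:~R else 0.
  move=> tc tr b c i j.
  have [wc wl] := omP b j; have [vc vl] := omP (t (+) b) j.
  pose v := conj_pull tauF k (om b j).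
  have pc : closed_form corner v by exact: (conj_pull_closed qs).
  have pl : local_holo rho v by exact: (conj_pull_local qs).
  have per_hom P d a : homologous corner (tau_chain corner tau tauF (chain_of P)) d ->
      period (t (+) a) v P = 2 * (chain_int d (part a (om b j)))^*.
    move=> hom; rewrite (period_conj_pull qs tauK kE tc) addbA addbb addFb.
    by rewrite (homologous_int (part_closed qs a wc wl) hom).
  have conj2 (z : R[i]) : 2 * z^* = (2 * z)^* by rewrite rmorphM /= conjC_nat.
  have v_a a l : period (t (+) a) v (alpha l) = ((b == a) && (l == j))%:R.
    by rewrite (per_hom _ _ a (ta l)) conj2 -/(period _ _ _) om_a conjC_nat.
  have vE e : om (t (+) b) j e = v e.
    apply/eqP; rewrite -subr_eq0; apply/eqP; move: e.
    apply: (holo_eq0 qs rho0 sy (closed_formB vc pc)) => [Q|a l].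
      have [e1 e2 e3] := vl Q; have [f1 f2 f3] := pl Q.
      by rewrite e1 e2 e3 f1 f2 f3; split; ring.
    transitivity (period a (om (t (+) b) j) (alpha l) - period a v (alpha l)).
      rewrite /period -mulrBr -sumrB; congr (2 * _); apply: eq_bigr => e _.
      by rewrite /part; case: ifP; rewrite ?mulrBr // mulr0 subrr.
    rewrite (_ : a = t (+) (t (+) a)); last by rewrite addbA addbb.
    rewrite v_a om_a (inj_eq (can_inj (addKb t))); exact: subrr.
  transitivity (period (t (+) c) v (beta i) + (period c (om b j) (beta i))^*).
    congr (_ + _); congr (2 * _); apply: eq_bigr => e _.
    by rewrite /part vE.
  (* The term [- chain_of (beta i)] yields minus the conjugate b-period, cancelled by the second
     summand. *)
  rewrite (per_hom _ _ c (tb i)) (chain_intD _ (fun e => - chain_of (beta i) e)).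
  rewrite chain_intN chain_int_sum conj2 mulrDr mulrN -/(period _ _ _) rmorphB /= subrK mulr_sumr.
  transitivity ((\sum_l (h l i)%:~R * ((b == c) && (l == j))%:R)^* : R[i]).
    congr (_^* ); apply: eq_bigr => l _; rewrite -om_a chain_intZ /period; ring.
  (* Normalization leaves only [h j i], which symmetry turns into [h i j]. *)
  rewrite (bigD1 j) //= big1 => [|l /negbTE ->]; last by rewrite andbF mulr0.
  rewrite eqxx andbT addr0 rmorphM /= rmorph_int conjC_nat (hP j i).1.
  by case: (b == c); rewrite ?mulr1 ?mulr0.
have PiE : [/\ forall i j, PiBB i j = period true (om true j) (beta i),
   forall i j, PiWB i j = period false (om true j) (beta i),
   forall i j, PiBW i j = period true (om false j) (beta i) &
   forall i j, PiWW i j = period false (om false j) (beta i)].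
  by split=> i j; rewrite !mxE -?(bper_period qs) -?(wper_period qs).
have [PBB PWB PBW PWW] := PiE; split=> -[tc tr] i j.
  have {}key b c := key false tc tr b c i j.
  have twoRe (z : R[i]) : 2 * 'Re z = z + z^*.
    by rewrite ReE mulrC divfK // pnatr_eq0.
  have Re0 (z : R[i]) : z + z^* = 0 -> 'Re z = 0 by rewrite ReE => ->; rewrite mul0r.
  rewrite !twoRe PBB PWB PBW PWW; split; [exact: (key true true) | exact: (key false false)| |].
    by apply: Re0; exact: (key true false).
  by apply: Re0; exact: (key false true).
(* The indices [b c] describe the conjugated period; the other one has both colors swapped. *)
have {}key b c := key true tc tr b c i j.
rewrite PBB PWB PBW PWW; split; [exact: (key false false) | exact: (key false true)].
Qed.
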